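(* For any integer $k \geq 3$ and any prime $p \geq 2^{32(k-1)^2\log_2^2(16(k-1))}$ there exists a subset $A \subseteq \mathbb{F}_p$ of size $|A| \leq \frac{10}{k-1}\frac{\log_{2} p}{\log_{2}\log_{2} p}$ which is not $F_k$-ring-isomorphic to any subset of any integral domain of characteristic zero.
   Context: For a polynomial $f \in \mathbb{Z}[x_1,\ldots,x_n]$, $\|f\|_1$ denotes the sum of the absolute values of its coefficients; $f$ is called $k$-bounded if $\|f\|_1 \leq k$ and $\deg f \leq k$. For rings $R_1,R_2$ and finite subsets $A\subseteq R_1$, $B\subseteq R_2$, a bijection $\phi: A\to B$ is an $F_k$-ring-isomorphism if, writing $A=\{a_1,\ldots,a_n\}$, for every $k$-bounded $f\in\mathbb{Z}[x_1,\ldots,x_n]$ we have $f(a_1,\ldots,a_n)=0$ if and only if $f(\phi(a_1),\ldots,\phi(a_n))=0$. A set $A$ is $F_k$-ring-isomorphic to $B$ if such a bijection exists. *)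

(* Defs.v *)
From HB Require Import structures.
From mathcomp Require Import all_boot all_order all_algebra finmap.
From mathcomp Require Import mpoly.
From mathcomp Require Import reals exp.

Set Implicit Arguments.
Unset Strict Implicit.
Unset Printing Implicit Defensive.

Import GRing.Theory Num.Theory.
Local Open Scope ring_scope.

Definition log2 (R : realType) (x : R) : R := ln x / ln 2.

Definition mnorm1 (n : nat) (f : {mpoly int[n]}) : int :=
  \sum_(m <- msupp f) `|f@_m|.

(* [msize f] is the total degree plus one, and [msize 0 = 0]. *)
Definition bounded_mpoly (k n : nat) (f : {mpoly int[n]}) : Prop :=
  mnorm1 f <= k%:Z /\ (msize f <= k.+1)%N.

Definition zeval (R : comNzRingType) (n : nat) (v : 'I_n -> R)
    (f : {mpoly int[n]}) : R :=
  mmap intr v f.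

(* The elements of A are listed as [enum_val i]; since boundedness is invariant
   under permuting the variables, the choice of the listing is immaterial. *)
Definition Fk_ring_isomorphism (k : nat) (R1 R2 : comNzRingType)
    (A : {fset R1}) (B : {fset R2}) (phi : A -> B) : Prop :=
  bijective phi /\
  forall f : {mpoly int[#|{: A}|]}, bounded_mpoly k f ->
    (zeval (fun i => val (enum_val i : A)) f = 0 <->
     zeval (fun i => val (phi (enum_val i))) f = 0).

Definition Fk_ring_isomorphic (k : nat) (R1 R2 : comNzRingType)
    (A : {fset R1}) (B : {fset R2}) : Prop :=
  exists phi : A -> B, Fk_ring_isomorphism k phi.

(* Main.v *)
Require Import Defs.
From mathcomp Require Import all_boot all_order all_algebra finmap.
From mathcomp Require Import mpoly.
From mathcomp Require Import reals exp.
From mathcomp Require Import zify ring lra.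
Import Order.TTheory GRing.Theory Num.Theory.
Local Open Scope ring_scope.

(* Let L = log2 p, b = floor(sqrt L) + 1, B = b ^ (k - 2).  The set A consists
   of the residues of 0, ..., b and of the quotients p %/ B ^ j.  A k-bounded
   isomorphism phi into a domain D fixes 0 and 1 (as 1 is the only nonzero root
   of x ^ 2 = x), hence 2, ..., b through m + 1 = (m) + (1); then, from the
   top one down, it fixes every quotient N = p %/ B ^ j, because
     N = (N %/ B) * b ^ (k - 2) + \sum_(i < k - 2) d_i * b ^ i
   with base-b digits d_i is a relation of norm k and degree k - 1.  For N = p,
   which vanishes in 'F_p, the same relation gives p = 0 in D.  There are about
   L / log2 B quotients, which with sqrt L small digits gives the size of A. *)

(** * Coefficient norm and degree of integer polynomials *)

(** Monomials outside the support contribute 0; a common list of monomials lets norms of different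
    polynomials be compared termwise. *)
Lemma mnorm1_supset (n : nat) (f : {mpoly int[n]}) (r : seq 'X_{1..n}) :
  uniq r -> {subset msupp f <= r} -> mnorm1 f = \sum_(m <- r) `|f@_m|.
Proof.
move=> r_uniq sub_fr; rewrite (bigID (fun m => m \in msupp f)) /=.
rewrite [X in _ = _ + X]big1 ?addr0; last first.
  by move=> m; rewrite -mcoeff_eq0 => /eqP ->; rewrite normr0.
rewrite -big_filter; apply: perm_big; apply: uniq_perm.
- exact: msupp_uniq.
- exact: filter_uniq.
move=> m; rewrite mem_filter.
by case: (boolP (m \in msupp f)) => // /sub_fr ->.
Qed.

Lemma mnorm1D {n : nat} (f g : {mpoly int[n]}) :
  mnorm1 (f + g) <= mnorm1 f + mnorm1 g.
Proof.
pose r := undup (msupp f ++ msupp g).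
have r_uniq : uniq r by exact: undup_uniq.
rewrite !(@mnorm1_supset _ _ r) //.
- by rewrite -big_split; apply: ler_sum => m _; rewrite mcoeffD ler_normD.
- by move=> m gm; rewrite mem_undup mem_cat gm orbT.
- by move=> m fm; rewrite mem_undup mem_cat fm.
- by move=> m /msuppD_le; rewrite mem_undup.
Qed.

Lemma mnorm1N (n : nat) (f : {mpoly int[n]}) : mnorm1 (- f) = mnorm1 f.
Proof.
rewrite [LHS](@mnorm1_supset _ _ (msupp f)) ?msupp_uniq //.
  by apply: eq_bigr => m _; rewrite mcoeffN normrN.
by move=> m; rewrite (perm_mem (msuppN f)).
Qed.

(** Separate budgets, since under sums norms add up while the degree does not grow; [c = d = k] is
    [bounded_mpoly k]. *)
Definition norm_deg_bounded (c d : nat) {n : nat} (f : {mpoly int[n]}) : Prop :=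
  mnorm1 f <= c%:Z /\ (msize f <= d.+1)%N.

Lemma norm_deg_bounded_le (c c' d d' n : nat) (f : {mpoly int[n]}) :
  (c <= c')%N -> (d <= d')%N ->
  norm_deg_bounded c d f -> norm_deg_bounded c' d' f.
Proof.
move=> le_c le_d [f_norm f_size]; split; last exact: leq_trans f_size _.
by apply: le_trans f_norm _; rewrite lez_nat.
Qed.

Lemma norm_deg_boundedD (c c' d n : nat) (f g : {mpoly int[n]}) :
  norm_deg_bounded c d f -> norm_deg_bounded c' d g ->
  norm_deg_bounded (c + c') d (f + g).
Proof.
move=> [f_norm f_size] [g_norm g_size]; split.
  by apply: le_trans (mnorm1D f g) _; rewrite PoszD lerD.
by apply: leq_trans (msizeD_le f g) _; rewrite geq_max f_size.
Qed.

Lemma norm_deg_boundedN (c d n : nat) (f : {mpoly int[n]}) :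
  norm_deg_bounded c d f -> norm_deg_bounded c d (- f).
Proof. by move=> [f_norm f_size]; split; rewrite ?mnorm1N ?msizeN. Qed.

Lemma norm_deg_bounded0 (d n : nat) : norm_deg_bounded 0 d (0 : {mpoly int[n]}).
Proof. by split; rewrite ?msize0 // /mnorm1 msupp0 big_nil. Qed.

Lemma norm_deg_boundedX (d n : nat) (m : 'X_{1..n}) :
  (mdeg m <= d)%N -> norm_deg_bounded 1 d ('X_[m] : {mpoly int[n]}).
Proof.
by split; rewrite ?msizeX // /mnorm1 msuppX big_seq1 mcoeffX eqxx normr1.
Qed.

Lemma norm_deg_bounded_sum (c d n : nat) (F : 'I_c -> {mpoly int[n]}) :
  (forall i, norm_deg_bounded 1 d (F i)) ->
  norm_deg_bounded c d (\sum_i F i).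
Proof.
elim: c F => [|c IHc] F F_bd.
  by rewrite big_ord0; exact: norm_deg_bounded0.
rewrite big_ord_recr /= -[X in norm_deg_bounded X]addn1.
apply: norm_deg_boundedD => //.
exact: IHc.
Qed.

Lemma zevalU (R : comNzRingType) (n : nat) (v : 'I_n -> R) (i : 'I_n) :
  zeval v 'X_i = v i.
Proof. by rewrite /zeval mmapX mmap1U. Qed.

(** The base and the digits are variables, not integer coefficients, so the norm depends only on the
    number of digits, however large the base. *)
Definition horner_mpoly {n r : nat} (x b : 'I_n) (d : 'I_r -> 'I_n) :
    {mpoly int[n]} :=
  'X_x * 'X_b ^+ r + \sum_(i < r) 'X_(d i) * 'X_b ^+ i.

Lemma horner_mpoly_bounded (n r : nat) (x b : 'I_n) (d : 'I_r -> 'I_n) :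
  norm_deg_bounded r.+1 r.+1 (horner_mpoly x b d).
Proof.
have XUX (i j : 'I_n) (l : nat) : (l <= r)%N ->
    norm_deg_bounded 1 r.+1 ('X_i * 'X_j ^+ l : {mpoly int[n]}).
  move=> le_lr; rewrite mpolyXn -mpolyXD; apply: norm_deg_boundedX.
  by rewrite mdegD mdegMn !mdeg1 mul1n.
rewrite -[X in norm_deg_bounded X]add1n.
apply: norm_deg_boundedD; first exact: XUX.
by apply: norm_deg_bounded_sum => i; apply: XUX; exact: ltnW.
Qed.

Lemma zeval_horner (R : comNzRingType) (n r : nat) (v : 'I_n -> R)
    (x b : 'I_n) (d : 'I_r -> 'I_n) :
  zeval v (horner_mpoly x b d) =
  v x * v b ^+ r + \sum_(i < r) v (d i) * v b ^+ i.
Proof.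
rewrite /zeval rmorphD rmorphM rmorphXn rmorph_sum /= -!/(zeval _ _) !zevalU.
by congr (_ + _); apply: eq_bigr => i _; rewrite /zeval rmorphM rmorphXn /=
  -!/(zeval _ _) !zevalU.
Qed.

(** * Transfer of bounded relations to a domain *)

Section IsomorphismTransfer.
Variables (k : nat) (R1 : comNzRingType) (D : idomainType).
Variables (A : {fset R1}) (B : {fset D}) (phi : A -> B).
Hypotheses (k_ge3 : (3 <= k)%N) (phi_iso : Fk_ring_isomorphism k phi).

Let val1 (i : 'I_#|{: A}|) : R1 := val (enum_val i : A).
Let val2 (i : 'I_#|{: A}|) : D := val (phi (enum_val i)).

Let val1_rank (a : A) : val1 (enum_rank a) = val a.
Proof. by rewrite /val1 enum_rankK. Qed.

Let val2_rank (a : A) : val2 (enum_rank a) = val (phi a).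
Proof. by rewrite /val2 enum_rankK. Qed.

Let transfer (f : {mpoly int[#|{: A}|]}) :
  norm_deg_bounded k k f -> zeval val1 f = 0 <-> zeval val2 f = 0.
Proof. by case: phi_iso => _; exact. Qed.

Let bounded_U (i : 'I_#|{: A}|) :
  norm_deg_bounded 1 k ('X_i : {mpoly int[#|{: A}|]}).
Proof. by apply: norm_deg_boundedX; rewrite mdeg1 (leq_trans _ k_ge3). Qed.

Lemma iso_eq0 (a : A) : val a = 0 <-> val (phi a) = 0.
Proof.
rewrite -val1_rank -val2_rank -(zevalU _ _ val1) -(zevalU _ _ val2).
apply: transfer; apply: norm_deg_bounded_le (bounded_U _) => //.
exact: leq_trans k_ge3.
Qed.

Lemma iso_one (a : A) : val a = 1 -> val (phi a) = 1.
Proof.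
move=> a1; set i := enum_rank a.
(* The converse half of the equivalence excludes the root 0 of [x ^ 2 = x]. *)
have phia_neq0 : val (phi a) != 0.
  by apply/eqP => /iso_eq0; rewrite a1 => /eqP; rewrite oner_eq0.
have zevalE (R : comNzRingType) (v : 'I_#|{: A}| -> R) :
    zeval v ('X_i * 'X_i - 'X_i) = v i * v i - v i.
  by rewrite /zeval rmorphB rmorphM /= -!/(zeval _ _) zevalU.
have /transfer[+ _] : norm_deg_bounded k k ('X_i * 'X_i - 'X_i).
  apply: (@norm_deg_bounded_le (1 + 1) _ k) => //; first by lia.
  apply: norm_deg_boundedD; last exact: norm_deg_boundedN.
  rewrite -mpolyXD; apply: norm_deg_boundedX; rewrite mdegD !mdeg1.
  exact: leq_trans k_ge3.
rewrite !zevalE val1_rank val2_rank a1 mulr1 subrr => /(_ erefl)/eqP.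
by rewrite subr_eq0 -{3}[val _]mulr1 => /eqP/(mulfI phia_neq0).
Qed.

(** The relation has norm at most 3, whence [3 <= k]. The elements may coincide, as in 1 + 1 = 2:
    the bound rests on the triangle inequality alone. *)
Lemma iso_add (a b c : A) :
  val c = val a + val b -> val (phi c) = val (phi a) + val (phi b).
Proof.
move=> cE.
have zevalE (R : comNzRingType) (v : 'I_#|{: A}| -> R) :
    zeval v ('X_(enum_rank a) + 'X_(enum_rank b) - 'X_(enum_rank c)) =
    v (enum_rank a) + v (enum_rank b) - v (enum_rank c).
  by rewrite /zeval rmorphB rmorphD /= -!/(zeval _ _) !zevalU.
have /transfer[+ _] : norm_deg_bounded k k
    ('X_(enum_rank a) + 'X_(enum_rank b) - 'X_(enum_rank c)).
  apply: (@norm_deg_bounded_le (1 + 1 + 1) _ k) => //.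
  apply: norm_deg_boundedD; last exact: norm_deg_boundedN.
  exact: norm_deg_boundedD.
rewrite !zevalE !val1_rank !val2_rank cE subrr => /(_ erefl)/eqP.
by rewrite subr_eq0 => /eqP.
Qed.

Let rank_horner (x b : A) (d : 'I_(k - 2) -> A) :=
  horner_mpoly (enum_rank x) (enum_rank b) (fun i => enum_rank (d i)).

Let zeval1_horner (x b : A) (d : 'I_(k - 2) -> A) :
  zeval val1 (rank_horner x b d) =
  val x * val b ^+ (k - 2) + \sum_(i < k - 2) val (d i) * val b ^+ i.
Proof.
rewrite zeval_horner !val1_rank; congr (_ + _).
by apply: eq_bigr => i _; rewrite val1_rank.
Qed.

Let zeval2_horner (x b : A) (d : 'I_(k - 2) -> A) :
  zeval val2 (rank_horner x b d) =
  val (phi x) * val (phi b) ^+ (k - 2) +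
    \sum_(i < k - 2) val (phi (d i)) * val (phi b) ^+ i.
Proof.
rewrite zeval_horner !val2_rank; congr (_ + _).
by apply: eq_bigr => i _; rewrite val2_rank.
Qed.

Let rank_horner_bounded (x b : A) (d : 'I_(k - 2) -> A) :
  norm_deg_bounded (k - 1) k (rank_horner x b d).
Proof. apply: norm_deg_bounded_le (horner_mpoly_bounded _ _ _ _ _); lia. Qed.

(** The leading term, [k - 2] digit terms and [y] exhaust the norm budget [k]; this dictates the
    number of digits. *)
Lemma iso_horner (x b : A) (d : 'I_(k - 2) -> A) (y : A) :
  val y = val x * val b ^+ (k - 2) + \sum_(i < k - 2) val (d i) * val b ^+ i ->
  val (phi y) = val (phi x) * val (phi b) ^+ (k - 2) +
    \sum_(i < k - 2) val (phi (d i)) * val (phi b) ^+ i.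
Proof.
move=> yE; set f := rank_horner x b d.
have zevalE (R : comNzRingType) (v : 'I_#|{: A}| -> R) :
    zeval v (f - 'X_(enum_rank y)) = zeval v f - v (enum_rank y).
  by rewrite /zeval rmorphB /= -!/(zeval _ _) zevalU.
have /transfer[+ _] : norm_deg_bounded k k (f - 'X_(enum_rank y)).
  apply: (@norm_deg_bounded_le (k - 1 + 1) _ k) => //; first by lia.
  apply: norm_deg_boundedD; first exact: rank_horner_bounded.
  exact: norm_deg_boundedN.
rewrite !zevalE zeval1_horner zeval2_horner val1_rank val2_rank yE.
by rewrite subrr => /(_ erefl)/eqP; rewrite subr_eq0 => /eqP.
Qed.

Lemma iso_horner_eq0 (x b : A) (d : 'I_(k - 2) -> A) :
  val x * val b ^+ (k - 2) + \sum_(i < k - 2) val (d i) * val b ^+ i = 0 ->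
  val (phi x) * val (phi b) ^+ (k - 2) +
    \sum_(i < k - 2) val (phi (d i)) * val (phi b) ^+ i = 0.
Proof.
move=> h0; have /transfer[+ _] : norm_deg_bounded k k (rank_horner x b d).
  apply: norm_deg_bounded_le (rank_horner_bounded _ _ _) => //; exact: leq_subr.
by rewrite zeval1_horner zeval2_horner; exact.
Qed.

End IsomorphismTransfer.

Arguments iso_eq0 {k R1 D A B phi}.
Arguments iso_one {k R1 D A B phi}.
Arguments iso_add {k R1 D A B phi}.
Arguments iso_horner {k R1 D A B phi}.
Arguments iso_horner_eq0 {k R1 D A B phi}.

(** * Digit expansions and the witness set *)

Lemma horner_digits (N b r : nat) :
  N = (N %/ b ^ r * b ^ r + \sum_(i < r) N %/ b ^ i %% b * b ^ i)%N.
Proof.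
elim: r => [|r {1}->]; first by rewrite big_ord0 divn1 muln1 addn0.
rewrite big_ord_recr /= expnSr divnMA {1}(divn_eq (N %/ b ^ r) b) mulnDl.
by rewrite -mulnA [(b * _)%N]mulnC -addnA [(_ * _ + \sum_(_ < _) _)%N]addnC.
Qed.

(** The small part includes [b] itself, which serves as the base. The exponent 0 is left out because
    [p] has residue 0. *)
Definition witness_seq (p b r J : nat) : seq nat :=
  iota 0 b.+1 ++ [seq (p %/ (b ^ r) ^ j)%N | j <- iota 1 J].

Definition witness_fset (p b r J : nat) : {fset 'F_p} :=
  [fset x in [seq m%:R | m <- witness_seq p b r J]]%fset.

Lemma card_witness_fset (p b r J : nat) :
  (#|` witness_fset p b r J| <= b + J + 1)%N.
Proof.
rewrite card_fseq (leq_trans (size_undup _)) // size_map size_cat size_map.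
by rewrite !size_iota addSn addn1.
Qed.

(** * Rigidity of the witness set *)

Section Rigidity.
Variables (p b k J : nat) (D : idomainType).
Let A := witness_fset p b (k - 2) J.
Variables (B : {fset D}) (phi : A -> B).
Hypotheses (p_prime : prime p) (b_gt0 : (0 < b)%N) (k_ge3 : (3 <= k)%N).
Hypothesis p_lt : (p < (b ^ (k - 2)) ^ J.+1)%N.
Hypothesis phi_iso : Fk_ring_isomorphism k phi.

(** This holds vacuously if the residue of [m] is not in [A]; membership is established
    separately. *)
Let determined (m : nat) := forall a : A, val a = m%:R -> val (phi a) = m%:R.

Let witness_elt (m : nat) :
  m \in witness_seq p b (k - 2) J -> exists a : A, val a = m%:R.
Proof.
move=> /(map_f (fun m => m%:R : 'F_p)) m_in.
have m_inA : m%:R \in A.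
  by rewrite /A /witness_fset; move: m_in; move: (map _ _) => s; rewrite inE.
by exists [` m_inA]%fset.
Qed.

Let small_elt (m : nat) : (m <= b)%N -> exists a : A, val a = m%:R.
Proof.
by move=> m_le; apply: witness_elt; rewrite mem_cat mem_iota ltnS m_le.
Qed.

Let small_determined (m : nat) : (m <= b)%N -> determined m.
Proof.
elim: m => [_ a /(iso_eq0 k_ge3 phi_iso)//|[|m] IHm m_le a aE].
  exact: (iso_one k_ge3 phi_iso).
have [c cE] := small_elt _ (ltnW m_le); have [e eE] := small_elt 1 b_gt0.
have -> : val (phi a) = val (phi c) + val (phi e).
  by apply: (iso_add k_ge3 phi_iso); rewrite aE cE eE natr1.
by rewrite (IHm (ltnW m_le)) // (iso_one k_ge3 phi_iso) // natr1.
Qed.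

(** The exponent [J.+1] is allowed as well: by [p_lt] its quotient is 0, a small element. *)
Let quotient_elt (j : nat) :
  (0 < j <= J.+1)%N -> exists a : A, val a = (p %/ (b ^ (k - 2)) ^ j)%:R.
Proof.
case/andP=> j_gt0; rewrite leq_eqVlt => /predU1P[-> | j_le].
  by rewrite divn_small //; exact: small_elt.
apply: witness_elt; rewrite mem_cat; apply/orP; right.
by apply: map_f; rewrite mem_iota j_gt0.
Qed.

Let digit_elts (N : nat) : exists d : 'I_(k - 2) -> A,
  forall i, val (d i) = (N %/ b ^ i %% b)%:R.
Proof.
(* The boolean equality lets [xchoose] select a digit element for every [i]. *)
have dP (i : 'I_(k - 2)) : exists a : A, val a == (N %/ b ^ i %% b)%:R.
  have [a aE] := small_elt (N %/ b ^ i %% b) (ltnW (ltn_pmod _ b_gt0)).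
  by exists a; apply/eqP.
by exists (fun i => xchoose (dP i)) => i; apply/eqP; exact: (xchooseP (dP i)).
Qed.

(** The ring is arbitrary because the expansion is read both in ['F_p] and in [D]. *)
Let natr_horner_digits (R : nzRingType) (N : nat) :
  N%:R = (N %/ b ^ (k - 2))%:R * b%:R ^+ (k - 2) +
    \sum_(i < k - 2) (N %/ b ^ i %% b)%:R * b%:R ^+ i :> R.
Proof.
rewrite {1}(horner_digits N b (k - 2)) natrD natrM natrX natr_sum.
by congr (_ + _); apply: eq_bigr => i _; rewrite natrM natrX.
Qed.

(** The induction lowers the exponent from [J.+1], where the quotient is 0, to 1. *)
Let quotient_determined (i : nat) :
  (i <= J)%N -> determined (p %/ (b ^ (k - 2)) ^ (J.+1 - i)).
Proof.
elim: i => [_|i IHi i_lt] a.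
  by rewrite subn0 divn_small //; exact: small_determined.
rewrite subSS; set N := (_ %/ _)%N => aE.
have NE : (p %/ (b ^ (k - 2)) ^ (J.+1 - i) = N %/ b ^ (k - 2))%N.
  by rewrite subSn ?(ltnW i_lt) // expnSr divnMA.
have [x xE] : exists x : A, val x = (N %/ b ^ (k - 2))%:R.
  by rewrite -NE; apply: quotient_elt; rewrite leq_subr subn_gt0 ltnS ltnW.
have phixE : val (phi x) = (N %/ b ^ (k - 2))%:R.
  by rewrite -NE; apply: (IHi (ltnW i_lt)); rewrite NE.
have [beta betaE] := small_elt b (leqnn b).
have [d dE] := digit_elts N.
rewrite (iso_horner k_ge3 phi_iso x beta d).
  rewrite (small_determined b (leqnn b) beta) // phixE.
  rewrite [RHS]natr_horner_digits; congr (_ + _); apply: eq_bigr => j _.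
  by rewrite (small_determined _ (ltnW (ltn_pmod _ b_gt0)) (d j) (dE j)).
rewrite aE betaE xE [LHS]natr_horner_digits; congr (_ + _).
by apply: eq_bigr => j _; rewrite dE.
Qed.

Lemma witness_pchar : p \in [pchar D].
Proof.
rewrite inE p_prime /=; apply/eqP.
have [x xE] : exists x : A, val x = (p %/ b ^ (k - 2))%:R.
  by rewrite -[(b ^ _)%N]expn1; exact: quotient_elt.
have phixE : val (phi x) = (p %/ b ^ (k - 2))%:R.
  have := quotient_determined J (leqnn J) x.
  by rewrite subSnn expn1; exact.
have [beta betaE] := small_elt b (leqnn b).
have [d dE] := digit_elts p.
rewrite natr_horner_digits -phixE -(small_determined b (leqnn b) beta) //.
have -> : \sum_(i < k - 2) (p %/ b ^ i %% b)%:R * val (phi beta) ^+ i =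
    \sum_(i < k - 2) val (phi (d i)) * val (phi beta) ^+ i.
  apply: eq_bigr => i _.
  by rewrite (small_determined _ (ltnW (ltn_pmod _ b_gt0)) (d i) (dE i)).
(* The expansion of [p] in [D] is now an image under [phi], so its vanishing can be checked in
   ['F_p]. *)
apply: iso_horner_eq0 => //; rewrite xE betaE.
rewrite (eq_bigr (fun i : 'I__ => (p %/ b ^ i %% b)%:R * b%:R ^+ i)).
  by rewrite -natr_horner_digits pchar_Fp_0.
by move=> i _; rewrite dE.
Qed.

End Rigidity.

(** * Estimates for the binary logarithm *)

Section Log2.
Variable R : realType.
Implicit Types x y s m L : R.

Lemma ln2_gt0 : 0 < ln 2 :> R.
Proof. by apply: ln_gt0; lra. Qed.

(** This is [ln (1 + x) <= x] at [x = - 1/2]. *)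
Lemma ln2_ge_half : 2^-1 <= ln 2 :> R.
Proof.
have := @le_ln1Dx R (- 2^-1); rewrite (_ : 1 + - 2^-1 = 2^-1 :> R); last by lra.
by rewrite lnV ?posrE // lerN2; apply; lra.
Qed.

Lemma log2M x y : 0 < x -> 0 < y -> log2 (x * y) = log2 x + log2 y.
Proof. by move=> x0 y0; rewrite /log2 lnM ?posrE // mulrDl. Qed.

Lemma log2X x (n : nat) : 0 < x -> log2 (x ^+ n) = n%:R * log2 x.
Proof. by move=> x0; rewrite /log2 lnXn // [RHS]mulr_natl mulrnAl. Qed.

Lemma ler_log2 x y : 0 < x -> x <= y -> log2 x <= log2 y.
Proof.
move=> x0 xy; rewrite /log2 ler_pM2r ?invr_gt0 ?ln2_gt0 //.
by rewrite ler_ln ?posrE // (lt_le_trans x0).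
Qed.

Lemma ltr_log2 x y : 0 < x -> 0 < y -> log2 x < log2 y -> x < y.
Proof.
by move=> x0 y0; rewrite /log2 ltr_pM2r ?invr_gt0 ?ln2_gt0 // ltr_ln ?posrE.
Qed.

Lemma log2_2 : log2 2 = 1 :> R.
Proof. by rewrite /log2 divff // gt_eqF ?ln2_gt0. Qed.

Lemma log2_le_double x : 0 < x -> log2 x <= 2 * x.
Proof.
move=> x0; rewrite /log2 ler_pdivrMr ?ln2_gt0 //.
have := ln_sublinear x0; have := ln2_ge_half; nra.
Qed.

Lemma powR2_le_log2 x y : 2 `^ x <= y -> x <= log2 y.
Proof.
move=> xy; have y0 : 0 < y by rewrite (lt_le_trans _ xy) // powR_gt0.
rewrite /log2 ler_pdivlMr ?ln2_gt0 // -ln_powR ler_ln ?posrE //.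
exact: powR_gt0.
Qed.

(** Meant for [m = k - 1] and [s ^+ 2 = log2 p]. With [t] and [u] as in the proof,
    [m * log2 (s ^+ 2)] is [2 * m * t + 2 * m * u], at most [2 * s / 5 + s / 4]. *)
Lemma sqrt_dominates_log2 m s :
  2 <= m -> 0 <= s -> 32 * m ^+ 2 * log2 (16 * m) ^+ 2 <= s ^+ 2 ->
  10 <= s /\ m * log2 (s ^+ 2) <= 3 * s.
Proof.
move=> m_ge2 s_ge0 s_large; set t := log2 (16 * m) in s_large.
have t_ge1 : 1 <= t by rewrite -log2_2; apply: ler_log2; lra.
have mt_ge2 : 2 <= m * t by nra.
(* The factor 5 comes from [5 ^ 2 <= 32]. *)
have s_ge : 5 * (m * t) <= s.
  rewrite -(@ler_pXn2r _ 2) ?nnegrE //; last by lra.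
  apply: le_trans s_large; rewrite -mulrA -[m ^+ 2 * _]exprMn [leLHS]exprMn.
  by rewrite ler_wpM2r ?sqr_ge0 //; lra.
have s_ge10 : 10 <= s by lra.
split=> //; rewrite log2X; last by lra.
(* [log2 s = t + log2 (s / (16 m))], and [log2 x <= 2 x] for the second term. *)
have u_gt0 : 0 < s / (16 * m) by apply: divr_gt0; lra.
have -> : log2 s = t + log2 (s / (16 * m)).
  rewrite -log2M //; last by lra.
  by rewrite mulrC divfK // gt_eqF //; lra.
have := log2_le_double _ u_gt0; set u := log2 (s / (16 * m)) => u_le.
have : m * u <= s / 8.
  apply: le_trans (_ : m * (2 * (s / (16 * m))) <= _).
    by rewrite ler_pM2l //; lra.
  rewrite le_eqVlt; apply/orP; left; apply/eqP; field.
  by rewrite gt_eqF //; lra.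
lra.
Qed.

End Log2.

(** * Choice of the parameters and conclusion *)

Lemma base_and_length (R : realType) (k p : nat) :
  (3 <= k)%N -> (0 < p)%N ->
  2 `^ (32 * (k%:R - 1) ^+ 2 * log2 (16 * (k%:R - 1)) ^+ 2) <= p%:R :> R ->
  exists b J : nat, [/\ (0 < b)%N, (p < (b ^ (k - 2)) ^ J.+1)%N &
    (b + J + 1)%:R <= 10 / (k%:R - 1) * (log2 p%:R / log2 (log2 p%:R)) :> R].
Proof.
move=> k_ge3 p_gt0 /powR2_le_log2.
have k_ge3R : 3 <= k%:R :> R by rewrite (ler_nat R 3 k).
set m : R := k%:R - 1; set L : R := log2 p%:R.
have m_ge2 : 2 <= m by rewrite /m; lra.
move=> L_large; pose s : R := Num.sqrt L.
have L_ge0 : 0 <= L.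
  apply: le_trans L_large; apply: mulr_ge0; last exact: sqr_ge0.
  by apply: mulr_ge0 => //; exact: sqr_ge0.
have sE : s ^+ 2 = L by rewrite sqr_sqrtr.
have [s_ge10] : 10 <= s /\ m * log2 (s ^+ 2) <= 3 * s.
  by apply: sqrt_dominates_log2; rewrite ?sqrtr_ge0 ?sE.
rewrite sE => mlog_le.
have logLE : log2 L = 2 * log2 s by rewrite -sE log2X //; lra.
have logs_ge1 : 1 <= log2 s by rewrite -log2_2; apply: ler_log2; lra.
(* The successor gives [s < b], so that [log2 b] is at least half of [log2 L], at a cost of at most
   1 in size. *)
pose b := (Num.truncn s).+1.
have s_lt_b : s < b%:R by exact: truncnS_gt.
have b_le : b%:R <= s + 1.
  by rewrite /b -natr1 lerD2r truncn_le sqrtr_ge0.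
have logb_ge : log2 s <= log2 b%:R by apply: ler_log2; [lra | exact: ltW].
set r : R := (k - 2)%:R.
have rE : r = m - 1 by rewrite /r natrB ?(ltnW k_ge3) // /m; lra.
(* Then [J.+1] exceeds the truncated quotient, which is [p < (b ^ (k - 2)) ^ J.+1] after taking
   logarithms. *)
pose J := Num.truncn (L / (r * log2 b%:R)).
have den_gt0 : 0 < r * log2 b%:R by apply: mulr_gt0; lra.
have J_le : J%:R <= L / (r * log2 b%:R).
  by rewrite truncn_le divr_ge0 // ltW.
exists b, J; split=> //.
  rewrite -(ltr_nat R) -expnM natrX; apply: ltr_log2.
  - by rewrite ltr0n.
  - by rewrite exprn_gt0 // ltr0n.
  rewrite log2X ?ltr0n // natrM -/r -/L mulrAC -ltr_pdivrMl //.
  by rewrite mulrC truncnS_gt.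
have mlogL_gt0 : 0 < m * log2 L by rewrite logLE; apply: mulr_gt0; lra.
(* One factor 2 comes from [m - 1 >= m / 2], the other from [log2 b >= log2 s = log2 L / 2]. *)
have J_le' : J%:R <= 4 * (L / (m * log2 L)).
  apply: le_trans J_le _; rewrite [leRHS]mulrCA ler_wpM2l //.
  rewrite -[4]invrK -invfM lef_pV2 ?posrE //; last first.
    by apply: mulr_gt0 => //; rewrite invr_gt0.
  rewrite logLE.
  have mlogs : m * log2 s <= m * log2 b%:R by rewrite ler_wpM2l //; lra.
  rewrite rE; nra.
have s_le : s <= 3 * (L / (m * log2 L)).
  rewrite mulrA ler_pdivlMr // -[X in _ <= 3 * X]sE expr2 [leRHS]mulrCA.
  by apply: ler_wpM2l => //; lra.
rewrite [leRHS](_ : _ = 10 * (L / (m * log2 L))); last first.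
  by rewrite mulf_div mulrA.
(* With [Q = L / (m * log2 L)], the size is at most [s + 2 + J], where [s <= 3 * Q], [J <= 4 * Q],
   and [2 <= s / 5] since [10 <= s]. *)
by rewrite !natrD; lra.
Qed.

Theorem theorem1p4 (R : realType) (k p : nat)
    (k_ge3 : (3 <= k)%N) (p_prime : prime p)
    (p_large : 2 `^ (32 * (k%:R - 1) ^+ 2 * log2 (16 * (k%:R - 1)) ^+ 2)
               <= p%:R :> R) :
  exists A : {fset 'F_p},
    (#|` A|%:R <= 10 / (k%:R - 1) * (log2 p%:R / log2 (log2 p%:R)) :> R) /\
    forall (D : idomainType), [pchar D] =i pred0 ->
      forall B : {fset D}, ~ Fk_ring_isomorphic k A B.

Proof.
have [b [J [b_gt0 p_lt size_le]]] :=
  base_and_length R k p k_ge3 (prime_gt0 p_prime) p_large.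
exists (witness_fset p b (k - 2) J); split.
  by apply: le_trans size_le; rewrite ler_nat card_witness_fset.
move=> D D_char0 B [phi phi_iso].
have := witness_pchar p b k J D B phi p_prime b_gt0 k_ge3 p_lt phi_iso.
(* Rigidity has put [p] among the characteristics of [D], of which there are none. *)
by rewrite D_char0.
Qed.
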